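(* Let $(\mathbb{N}_0,+,0)$ be the monoidal category whose underlying category is the poset $(\mathbb{N}_0,\leq)$, with tensor product given by addition and unit $0$. Bimonads on $(\mathbb{N}_0,+,0)$ correspond bijectively to non-trivial submonoids (i.e. submonoids different from $\{0\}$) of $(\mathbb{N}_0,+)$; the correspondence sends a bimonad $T$ to the image $S_T=\{T(m)\mid m\in\mathbb{N}_0\}$.
   Context: $\mathbb{N}_0=\{0,1,2,\dots\}$; the poset $(\mathbb{N}_0,\le)$ is viewed as a category with a unique arrow $m\to n$ exactly when $m\le n$. A bimonad on a monoidal category $(\mathcal{C},\otimes,1)$ is a monad $(T,\mu,\eta)$ together with a natural transformation $T_2(X,Y):T(X\otimes Y)\to T(X)\otimes T(Y)$ and a morphism $T_0:T(1)\to 1$ that are coassociative and counital (i.e. $T$ is a comonoidal functor) and such that $\mu,\eta$ are comonoidal: $T_2(X,Y)\mu_{X\otimes Y}=(\mu_X\otimes\mu_Y)T_2(T(X),T(Y))T(T_2(X,Y))$, $T_2(X,Y)\eta_{X\otimes Y}=\eta_X\otimes\eta_Y$, $T_0\mu_1=T_0T(T_0)$, $T_0\eta_1=\mathrm{id}_1$. *)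

(* Defs.v *)
From mathcomp Require Import all_boot.
From mathcomp Require Import classical_sets functions.

Set Implicit Arguments.
Unset Strict Implicit.
Unset Printing Implicit Defensive.

Local Open Scope nat_scope.

Declare Scope cat_scope.
Delimit Scope cat_scope with cat.
Local Open Scope cat_scope.

Record category := Category {
  obj :> Type;
  hom : obj -> obj -> Type;
  idm : forall X, hom X X;
  compm : forall X Y Z, hom Y Z -> hom X Y -> hom X Z;
  comp1m : forall X Y (f : hom X Y), compm (idm Y) f = f;
  compm1 : forall X Y (f : hom X Y), compm f (idm X) = f;
  compmA : forall X Y Z W (h : hom Z W) (g : hom Y Z) (f : hom X Y),
    compm h (compm g f) = compm (compm h g) f
}.

Arguments idm {c} X : rename.
Arguments compm {c X Y Z} g f : rename.
Notation "g ∘ f" := (compm g f) (at level 40, left associativity) : cat_scope.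

Record functor (C D : category) := Functor {
  fobj :> C -> D;
  fmap : forall X Y : C, hom X Y -> hom (fobj X) (fobj Y);
  fmap1 : forall X : C, fmap (idm X) = idm (fobj X);
  fmapM : forall (X Y Z : C) (g : hom Y Z) (f : hom X Y),
    fmap (g ∘ f) = fmap g ∘ fmap f
}.

Arguments fmap {C D} F {X Y} f : rename.

(* Not assumed strict: [assoc], [lunit], [runit] are the structural
   isomorphisms, with explicit inverses. *)
Record monoidal_category := MonoidalCategory {
  mcat :> category;
  munit : mcat;
  tens : mcat -> mcat -> mcat;
  tensm : forall X Y X' Y' : mcat,
    hom X X' -> hom Y Y' -> hom (tens X Y) (tens X' Y');
  tensm1 : forall X Y : mcat, tensm (idm X) (idm Y) = idm (tens X Y);
  tensmM : forall (X X' X'' Y Y' Y'' : mcat)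
      (g : hom X' X'') (f : hom X X') (k : hom Y' Y'') (h : hom Y Y'),
    tensm (g ∘ f) (k ∘ h) = tensm g k ∘ tensm f h;
  assoc : forall X Y Z : mcat, hom (tens (tens X Y) Z) (tens X (tens Y Z));
  assocV : forall X Y Z : mcat, hom (tens X (tens Y Z)) (tens (tens X Y) Z);
  lunit : forall X : mcat, hom (tens munit X) X;
  lunitV : forall X : mcat, hom X (tens munit X);
  runit : forall X : mcat, hom (tens X munit) X;
  runitV : forall X : mcat, hom X (tens X munit);
  assocK : forall X Y Z : mcat, assocV X Y Z ∘ assoc X Y Z = idm _;
  assocVK : forall X Y Z : mcat, assoc X Y Z ∘ assocV X Y Z = idm _;
  lunitK : forall X : mcat, lunitV X ∘ lunit X = idm _;
  lunitVK : forall X : mcat, lunit X ∘ lunitV X = idm _;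
  runitK : forall X : mcat, runitV X ∘ runit X = idm _;
  runitVK : forall X : mcat, runit X ∘ runitV X = idm _;
  assoc_nat : forall (X X' Y Y' Z Z' : mcat)
      (f : hom X X') (g : hom Y Y') (h : hom Z Z'),
    assoc X' Y' Z' ∘ tensm (tensm f g) h =
    tensm f (tensm g h) ∘ assoc X Y Z;
  lunit_nat : forall (X X' : mcat) (f : hom X X'),
    lunit X' ∘ tensm (idm munit) f = f ∘ lunit X;
  runit_nat : forall (X X' : mcat) (f : hom X X'),
    runit X' ∘ tensm f (idm munit) = f ∘ runit X;
  pentagon : forall W X Y Z : mcat,
    assoc W X (tens Y Z) ∘ assoc (tens W X) Y Z =
    tensm (idm W) (assoc X Y Z) ∘ assoc W (tens X Y) Z
      ∘ tensm (assoc W X Y) (idm Z);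
  triangle : forall X Y : mcat,
    tensm (idm X) (lunit Y) ∘ assoc X munit Y = tensm (runit X) (idm Y)
}.

Arguments munit {m} : rename.
Arguments tens {m} X Y : rename.
Arguments tensm {m X Y X' Y'} f g : rename.
Arguments assoc {m} X Y Z : rename.
Arguments lunit {m} X : rename.
Arguments runit {m} X : rename.

Notation "X ⊗ Y" := (tens X Y) (at level 37, left associativity) : cat_scope.
Notation "f ⊗ₘ g" := (tensm f g) (at level 37, left associativity) : cat_scope.

Record monad (C : category) := Monad {
  mfun :> functor C C;
  mu : forall X : C, hom (mfun (mfun X)) (mfun X);
  eta : forall X : C, hom X (mfun X);
  mu_nat : forall (X Y : C) (f : hom X Y),
    mu Y ∘ fmap mfun (fmap mfun f) = fmap mfun f ∘ mu X;
  eta_nat : forall (X Y : C) (f : hom X Y),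
    eta Y ∘ f = fmap mfun f ∘ eta X;
  mu_assoc : forall X : C, mu X ∘ fmap mfun (mu X) = mu X ∘ mu (mfun X);
  mu_unitl : forall X : C, mu X ∘ eta (mfun X) = idm (mfun X);
  mu_unitr : forall X : C, mu X ∘ fmap mfun (eta X) = idm (mfun X)
}.

Arguments mu {C} T X : rename.
Arguments eta {C} T X : rename.

Record comonoidal (C : monoidal_category) (T : functor C C) := Comonoidal {
  cm2 : forall X Y : C, hom (T (X ⊗ Y)) (T X ⊗ T Y);
  cm0 : hom (T munit) munit;
  cm2_nat : forall (X X' Y Y' : C) (f : hom X X') (g : hom Y Y'),
    cm2 X' Y' ∘ fmap T (f ⊗ₘ g) = (fmap T f ⊗ₘ fmap T g) ∘ cm2 X Y;
  cm2_coassoc : forall X Y Z : C,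
    assoc (T X) (T Y) (T Z) ∘ (cm2 X Y ⊗ₘ idm (T Z)) ∘ cm2 (X ⊗ Y) Z =
    (idm (T X) ⊗ₘ cm2 Y Z) ∘ cm2 X (Y ⊗ Z) ∘ fmap T (assoc X Y Z);
  cm_counitl : forall X : C,
    lunit (T X) ∘ (cm0 ⊗ₘ idm (T X)) ∘ cm2 munit X = fmap T (lunit X);
  cm_counitr : forall X : C,
    runit (T X) ∘ (idm (T X) ⊗ₘ cm0) ∘ cm2 X munit = fmap T (runit X)
}.

Record bimonad (C : monoidal_category) := Bimonad {
  bmonad :> monad C;
  bcomon : comonoidal bmonad;
  mu_cm2 : forall X Y : C,
    cm2 bcomon X Y ∘ mu bmonad (X ⊗ Y) =
    (mu bmonad X ⊗ₘ mu bmonad Y) ∘ cm2 bcomon (bmonad X) (bmonad Y)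
      ∘ fmap bmonad (cm2 bcomon X Y);
  eta_cm2 : forall X Y : C,
    cm2 bcomon X Y ∘ eta bmonad (X ⊗ Y) = eta bmonad X ⊗ₘ eta bmonad Y;
  mu_cm0 : cm0 bcomon ∘ mu bmonad munit = cm0 bcomon ∘ fmap bmonad (cm0 bcomon);
  eta_cm0 : cm0 bcomon ∘ eta bmonad munit = idm munit
}.

(* [m <= n] is a boolean equation, hence has at most one proof: there is at
   most one arrow m -> n, and all diagrams commute. *)
Definition nat_cat : category :=
  @Category nat (fun m n => m <= n) leqnn (fun _ _ _ g f => leq_trans f g)
    (fun _ _ _ => bool_irrelevance _ _) (fun _ _ _ => bool_irrelevance _ _)
    (fun _ _ _ _ _ _ _ => bool_irrelevance _ _).

Definition nat_monoidal : monoidal_category.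
Proof.
refine (@MonoidalCategory nat_cat 0 addn (fun _ _ _ _ f g => leq_add f g)
  _ _ (fun m n p => eq_leq (esym (addnA m n p)))
  (fun m n p => eq_leq (addnA m n p))
  (fun m => eq_leq (add0n m)) (fun m => eq_leq (esym (add0n m)))
  (fun m => eq_leq (addn0 m)) (fun m => eq_leq (esym (addn0 m)))
  _ _ _ _ _ _ _ _ _ _ _);
by move=> *; apply: bool_irrelevance.
Defined.

Definition submonoid (S : set nat) : Prop :=
  S 0 /\ forall m n, S m -> S n -> S (m + n).

(* Main.v *)
Require Import Defs.
From mathcomp Require Import all_boot.
From mathcomp Require Import boolp classical_sets functions.

(** Every hom-set of [nat_monoidal] has at most one element. Hence all diagrams
    in the definition of a bimonad commute, and a bimonad [T] amounts to a
    function [nat -> nat] for which the required arrows exist: it is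
    nondecreasing (functor), [m <= T m] and [T (T m) <= T m] (monad),
    [T (m + n) <= T m + T n] and [T 0 <= 0] (comonoidal functor). In other
    words, [T] is a closure operator that is subadditive and fixes [0].

    A closure operator is recovered from its image: [T m] is the least element
    of the image above [m] ([bimonad_least_above]). This gives injectivity,
    since a bimonad is determined by its function on objects
    ([bimonad_thin_eq]). The image is the set of fixed points of [T];
    subadditivity makes it a submonoid, and it contains [T 1 >= 1], so it is
    not trivial.

    Conversely, a submonoid [S] containing some [k > 0] contains all multiples
    of [k], so it is unbounded and every [m] has a least element of [S] above
    it ([submonoid_least_above]). Sending [m] to that element is a closure
    operator with image [S]. It is subadditive because the sum of elements of
    [S] above [m] and [n] is an element of [S] above [m + n], and it fixes [0]
    because [0] lies in [S]. *)

Set Implicit Arguments.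
Unset Strict Implicit.
Unset Printing Implicit Defensive.

Local Open Scope nat_scope.
Local Open Scope classical_set_scope.

(** * Bimonads on a thin category *)

Definition thin (C : category) : Prop :=
  forall (X Y : C) (f g : hom X Y), f = g.

(** Once the object maps are identified, the maps on arrows have the same type
    and take values in hom-sets with at most one element; the functor laws are
    propositions. The same argument works for the structures below. *)
Lemma functor_thin_eq (C D : category) (F G : functor C D) :
  thin D -> fobj F = fobj G -> F = G.
Proof.
case: F G => [F f f1 fM] [G g g1 gM] thinD /= eqFG.
case: G / eqFG g g1 gM => g g1 gM.
have eqfg : f = g.
  apply: functional_extensionality_dep => X.
  apply: functional_extensionality_dep => Y.
  by apply: functional_extensionality_dep => h; apply: thinD.
case: g / eqfg g1 gM => g1 gM.
by rewrite (Prop_irrelevance f1 g1) (Prop_irrelevance fM gM).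
Qed.

Lemma monad_thin_eq (C : category) (T U : monad C) :
  thin C -> mfun T = mfun U -> T = U.
Proof.
case: T U => [T m e mn en ma ml mr] [U m' e' mn' en' ma' ml' mr'] thinC /= eqTU.
case: U / eqTU m' e' mn' en' ma' ml' mr' => m' e' mn' en' ma' ml' mr'.
have eqm : m = m' by apply: functional_extensionality_dep => X; apply: thinC.
have eqe : e = e' by apply: functional_extensionality_dep => X; apply: thinC.
case: m' / eqm mn' ma' ml' mr' => mn' ma' ml' mr'.
case: e' / eqe en' ml' mr' => en' ml' mr'.
by congr Monad; apply: Prop_irrelevance.
Qed.

Lemma comonoidal_thin_eq (C : monoidal_category) (T : functor C C)
    (c d : comonoidal T) :
  thin C -> c = d.
Proof.
case: c d => [c2 c0 cn ca cl cr] [d2 d0 dn da dl dr] thinC.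
have eq2 : c2 = d2.
  apply: functional_extensionality_dep => X.
  by apply: functional_extensionality_dep => Y; apply: thinC.
have eq0 : c0 = d0 by apply: thinC.
case: d2 / eq2 dn da dl dr => dn da dl dr.
case: d0 / eq0 dl dr => dl dr.
by congr Comonoidal; apply: Prop_irrelevance.
Qed.

(** Apart from its function on objects, a bimonad consists of arrows and of
    equations between arrows. *)
Lemma bimonad_thin_eq (C : monoidal_category) (T U : bimonad C) :
  thin C -> fobj T = fobj U -> T = U.
Proof.
move=> thinC eqobj.
have {eqobj} := monad_thin_eq thinC (functor_thin_eq thinC eqobj).
case: T U => [T c m2 e2 m0 e0] [U d m2' e2' m0' e0'] /= eqTU.
case: U / eqTU d m2' e2' m0' e0' => d.
case: d / (comonoidal_thin_eq c d thinC) => m2' e2' m0' e0'.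
by congr Bimonad; apply: Prop_irrelevance.
Qed.

Lemma nat_cat_thin : thin nat_cat.
Proof. by move=> m n f g; apply: bool_irrelevance. Qed.

(** * Bimonads on the natural numbers as closure operators *)

(** The hypotheses are the arrows that a bimonad structure requires: the action
    on arrows, [eta], [mu], [cm2] and [cm0], in this order. *)
Lemma closure_bimonad (t : nat -> nat) :
    {homo t : m n / m <= n} -> (forall m, m <= t m) ->
    (forall m, t (t m) <= t m) -> (forall m n, t (m + n) <= t m + t n) ->
    t 0 <= 0 ->
  exists T : bimonad nat_monoidal, fobj T = t.
Proof.
move=> t_homo t_ge tt t_add t0.
pose F : functor nat_cat nat_cat :=
  @Functor nat_cat nat_cat t (fun m n => @t_homo m n)
    (fun _ => nat_cat_thin _ _) (fun _ _ _ _ _ => nat_cat_thin _ _).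
pose M := @Monad nat_cat F tt t_ge
  (fun _ _ _ => nat_cat_thin _ _) (fun _ _ _ => nat_cat_thin _ _)
  (fun _ => nat_cat_thin _ _) (fun _ => nat_cat_thin _ _)
  (fun _ => nat_cat_thin _ _).
pose c := @Comonoidal nat_monoidal M t_add t0
  (fun _ _ _ _ _ _ => nat_cat_thin _ _) (fun _ _ _ => nat_cat_thin _ _)
  (fun _ => nat_cat_thin _ _) (fun _ => nat_cat_thin _ _).
by exists (@Bimonad nat_monoidal M c
  (fun _ _ => nat_cat_thin _ _) (fun _ _ => nat_cat_thin _ _)
  (nat_cat_thin _ _) (nat_cat_thin _ _)).
Qed.

Definition least_above (S : set nat) (m n : nat) : Prop :=
  [/\ S n, m <= n & forall s, S s -> m <= s -> n <= s].

Lemma least_above_uniq (S : set nat) (m n p : nat) :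
  least_above S m n -> least_above S m p -> n = p.
Proof.
move=> [Sn mn n_le] [Sp mp p_le].
by apply/eqP; rewrite eqn_leq n_le // p_le.
Qed.

Section BimonadOnNat.

Variable T : bimonad nat_monoidal.

Lemma bimonad_idem (m : nat) : T (T m) = T m :> nat.
Proof.
apply/eqP; rewrite eqn_leq; apply/andP.
by split; [apply: (mu T m) | apply: (eta T (T m))].
Qed.

(** An element [T n >= m] of the image satisfies [T m <= T (T n) = T n]. *)
Lemma bimonad_least_above (m : nat) :
  least_above [set T m | m in [set: nat]] m (T m).
Proof.
split; [by exists m | exact: (eta T m) | move=> _ [n _ <-] mTn].
by rewrite -(bimonad_idem n); apply: (fmap T (mTn : @hom nat_cat m (T n))).
Qed.

(** A sum of fixed points is fixed, because
    [T (T m + T n) <= T (T m) + T (T n) = T m + T n]. *)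
Lemma bimonad_image_submonoid : submonoid [set T m | m in [set: nat]].
Proof.
split.
  exists 0 => //; apply/eqP; rewrite -leqn0; exact: (cm0 (bcomon T)).
move=> _ _ [m _ <-] [n _ <-]; exists (T m + T n) => //.
apply/eqP; rewrite eqn_leq; apply/andP; split; last exact: (eta T).
have /= := cm2 (bcomon T) (T m) (T n).
by rewrite !bimonad_idem.
Qed.

Lemma bimonad_image_nontrivial : [set T m | m in [set: nat]] <> [set 0].
Proof.
move=> im0; have : [set T m | m in [set: nat]] (T 1) by exists 1.
rewrite im0 => T1; have := eta T (1 : nat_cat).
by rewrite /= T1.
Qed.

End BimonadOnNat.

(** * Submonoids of the natural numbers *)

(** If [k > 0] lies in [S], then so does the multiple [m * k >= m]. *)
Lemma submonoid_unbounded (S : set nat) (m : nat) :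
  submonoid S -> S <> [set 0] -> exists2 s, S s & m <= s.
Proof.
move=> [S0 SD] S_neq0.
have [k Sk k_gt0] : exists2 k, S k & 0 < k.
  apply: contrapT => noS; apply: S_neq0; apply/seteqP; split=> [k Sk|_ -> //].
  by apply/eqP; rewrite -leqn0 leqNgt; apply/negP => k_gt0; apply: noS; exists k.
exists (m * k); last by rewrite leq_pmulr.
by elim: m => [//|m IHm]; rewrite mulSn; apply: SD.
Qed.

Lemma submonoid_least_above (S : set nat) (m : nat) :
  submonoid S -> S <> [set 0] -> exists n, least_above S m n.
Proof.
move=> S_mon S_neq0.
have exS : exists s, `[< S s >] && (m <= s).
  have [s Ss ms] := submonoid_unbounded m S_mon S_neq0.
  by exists s; rewrite ms andbT; apply/asboolP.
case: (ex_minnP exS) => n /andP[/asboolP Sn mn] n_le.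
by exists n; split=> // s Ss ms; apply: n_le; rewrite ms andbT; apply/asboolP.
Qed.

Lemma submonoid_bimonad (S : set nat) :
    submonoid S -> S <> [set 0] ->
  exists T : bimonad nat_monoidal, [set T m | m in [set: nat]] = S.
Proof.
move=> S_mon S_neq0.
have [t tP] := choice (fun m => submonoid_least_above m S_mon S_neq0).
have tS m : S (t m) by case: (tP m).
have t_ge m : m <= t m by case: (tP m).
have t_le m s : S s -> m <= s -> t m <= s by case: (tP m) => _ _; apply.
have [S0 SD] := S_mon.
have [||||T tE] := @closure_bimonad t _ t_ge.
- by move=> m n mn; apply: t_le (leq_trans mn _).
- by move=> m; apply: t_le.
- by move=> m n; apply: t_le; [apply: SD | apply: leq_add].
- exact: t_le.
exists T; rewrite tE; apply/seteqP; split=> [_ [m _ <-] //|s Ss].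
by exists s => //; apply/eqP; rewrite eqn_leq t_ge t_le.
Qed.

(** * The correspondence *)

Theorem lemma4p3 :
  set_bij [set: bimonad nat_monoidal]
    [set S : set nat | submonoid S /\ S <> [set 0]]
    (fun T : bimonad nat_monoidal => [set T m | m in [set: nat]]).
Proof.
split.
- move=> T _; split.
    exact: bimonad_image_submonoid.
  exact: bimonad_image_nontrivial.
- move=> T U _ _ imTU; apply: bimonad_thin_eq; first exact: nat_cat_thin.
  apply: functional_extensionality_dep => m.
  apply: (least_above_uniq (bimonad_least_above T m)).
  by rewrite imTU; apply: bimonad_least_above.
- move=> S [S_mon S_neq0].
  by have [T imT] := submonoid_bimonad S_mon S_neq0; exists T.
Qed.
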